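(* Let $f\colon \mathbb{R}^d \to \mathbb{R}$ be differentiable, let $l_1,\dots,l_d>0$, and let $\boldsymbol{L}=\operatorname{diag}(l_1,\dots,l_d)$ with associated norm $\Vert z\Vert_{\boldsymbol{L}} = \left(\sum_{i=1}^d l_i z_i^2\right)^{1/2}$. If $f$ is $1$-smooth with respect to $\Vert\cdot\Vert_{\boldsymbol{L}}$, then $f$ is $\left(\sum_{i=1}^d l_i\right)$-smooth with respect to the maximum norm $\Vert\cdot\Vert_\infty$.
   Context: For a norm $\Vert\cdot\Vert$ on $\mathbb{R}^d$, the dual norm is $\Vert z\Vert_\ast = \max_{\Vert x\Vert\le 1}\langle z,x\rangle$. A differentiable function $f\colon\mathbb{R}^d\to\mathbb{R}$ is called $L$-smooth with respect to $\Vert\cdot\Vert$ (for a constant $L>0$) if $\Vert\nabla f(x')-\nabla f(x)\Vert_\ast\le L\Vert x'-x\Vert$ for all $x,x'\in\mathbb{R}^d$. In particular, $L$-smoothness with respect to $\Vert\cdot\Vert_\infty$ means $\Vert\nabla f(x')-\nabla f(x)\Vert_1\le L\Vert x'-x\Vert_\infty$ for all $x,x'$. *)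

(* Defs.v *)
From HB Require Import structures.
From mathcomp Require Import all_boot all_order all_algebra.
From mathcomp Require Import all_classical all_reals all_analysis.
Set Implicit Arguments.
Unset Strict Implicit.
Unset Printing Implicit Defensive.
Import Order.TTheory GRing.Theory Num.Theory.
Import numFieldNormedType.Exports.
Local Open Scope classical_set_scope.
Local Open Scope ring_scope.

Definition inner (R : realType) (d : nat) (z x : 'rV[R]_d) : R :=
  \sum_(i < d) z 0 i * x 0 i.

(* [N] is meant to be a norm: the unit ball of [N] is then compact, so the
   supremum is a maximum.  ([sup] would be 0 on an unbounded set.) *)
Definition dual_norm (R : realType) (d : nat) (N : 'rV[R]_d -> R)
    (z : 'rV[R]_d) : R :=
  sup [set inner z x | x in [set x : 'rV[R]_d | N x <= 1]].

Definition grad (R : realType) (d : nat) (f : 'rV[R]_d -> R)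
    (x : 'rV[R]_d) : 'rV[R]_d :=
  \row_(i < d) 'D_(delta_mx 0 i) f x.

Definition smooth (R : realType) (d : nat) (N : 'rV[R]_d -> R) (L : R)
    (f : 'rV[R]_d -> R) : Prop :=
  [/\ 0 < L,
      forall x : 'rV[R]_d, differentiable f x
    & forall x x' : 'rV[R]_d,
        dual_norm N (grad f x' - grad f x) <= L * N (x' - x)].

(* The norm of ['M[R]_(m, n)] in the library is the largest absolute value of
   an entry, see [mx_normrE]. *)
Definition max_norm (R : realType) (d : nat) (z : 'rV[R]_d) : R := `|z|.

(* The norm associated with the diagonal matrix [diag(l_1, ..., l_d)]. *)
Definition diag_norm (R : realType) (d : nat) (l : 'I_d -> R)
    (z : 'rV[R]_d) : R :=
  Num.sqrt (\sum_(i < d) l i * z 0 i ^+ 2).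

(* Main.v *)
(* With S = \sum_i l_i one has diag_norm l x <= sqrt S * max_norm x.  Hence the
   unit ball of the maximum norm is contained in sqrt S times that of
   diag_norm l, so the dual norms compare with the same factor; one factor
   sqrt S comes from each side of the smoothness inequality. *)
Require Import Defs.
From HB Require Import structures.
From mathcomp Require Import all_boot all_order all_algebra.
From mathcomp Require Import all_classical all_reals all_analysis.
Set Implicit Arguments.
Unset Strict Implicit.
Unset Printing Implicit Defensive.
Import Order.TTheory GRing.Theory Num.Theory.
Import numFieldNormedType.Exports.
Local Open Scope classical_set_scope.
Local Open Scope ring_scope.

Lemma innerZr (R : realType) (d : nat) (c : R) (z x : 'rV[R]_d) :
  inner z (c *: x) = c * inner z x.
Proof.
by rewrite /inner mulr_sumr; apply: eq_bigr => i _; rewrite mxE mulrCA.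
Qed.

(** Each [x] in the unit ball of [M] is [c] times the point [c^-1 *: x] of the unit ball of [N]. The
    condition [M 0 <= 1] makes the left supremum one over a nonempty set; boundedness makes the
    right one dominate its elements. *)
Lemma dual_norm_le_scale (R : realType) (d : nat) (N M : 'rV[R]_d -> R) (c : R)
    (z : 'rV[R]_d) :
  0 < c -> M 0 <= 1 ->
  (forall x, M x <= 1 -> N (c^-1 *: x) <= 1) ->
  has_ubound [set inner z x | x in [set x | N x <= 1]] ->
  dual_norm M z <= c * dual_norm N z.
Proof.
move=> c0 M0 MN ubN; apply: ge_sup; first by exists (inner z 0), 0.
move=> _ [x /= Mx <-]; rewrite -ler_pdivrMl// -innerZr.
by apply: ub_le_sup => //; exists (c^-1 *: x) => //=; exact: MN.
Qed.

(** One term [l i * x 0 i ^+ 2] is at most the whole sum, all terms being nonnegative. *)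
Lemma diag_norm_coord (R : realType) (d : nat) (l : 'I_d -> R)
    (x : 'rV[R]_d) (i : 'I_d) :
  (forall j, 0 < l j) -> diag_norm l x <= 1 -> `|x 0 i| <= Num.sqrt (l i)^-1.
Proof.
move=> l0; rewrite -[1]sqrtr1 /diag_norm ler_sqrt// => x1.
rewrite -sqrtr_sqr ler_wsqrtr// -[leRHS]mulr1 -ler_pdivrMl ?invr_gt0//.
rewrite invrK; apply: le_trans x1.
rewrite (bigD1 i)//= lerDl sumr_ge0// => j _.
by rewrite mulr_ge0 ?sqr_ge0// ltW.
Qed.

(** Ensures that the dual norm of [diag_norm l] is a genuine supremum rather than the default value
    of [sup]. *)
Lemma has_ubound_inner_diag_norm (R : realType) (d : nat) (l : 'I_d -> R)
    (z : 'rV[R]_d) :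
  (forall i, 0 < l i) ->
  has_ubound [set inner z x | x in [set x | diag_norm l x <= 1]].
Proof.
move=> l0; exists (\sum_(i < d) `|z 0 i| * Num.sqrt (l i)^-1).
move=> _ [x /= x1 <-]; apply: ler_sum => i _.
by rewrite (le_trans (ler_norm _))// normrM ler_wpM2l// diag_norm_coord.
Qed.

Lemma diag_norm_le_max_norm (R : realType) (d : nat) (l : 'I_d -> R)
    (x : 'rV[R]_d) :
  (forall i, 0 <= l i) ->
  diag_norm l x <= Num.sqrt (\sum_(i < d) l i) * max_norm x.
Proof.
move=> l0; have x0 : 0 <= max_norm x by exact: normr_ge0.
(* The right side becomes a single root, so that the radicands compare term by term. *)
rewrite -[max_norm x]ger0_norm// -sqrtr_sqr -sqrtrM ?sumr_ge0//.
rewrite ler_wsqrtr// mulr_suml ler_sum// => i _.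
rewrite ler_wpM2l// -[leLHS]ger0_norm ?sqr_ge0// normrX lerXn2r ?nnegrE//.
rewrite /max_norm [leRHS]mx_normrE.
exact: (le_bigmax _ (fun ij : 'I_1 * 'I_d => `|x ij.1 ij.2|) (0, i)).
Qed.

Theorem proposition1 (R : realType) (d : nat) (hd : (0 < d)%N)
    (f : 'rV[R]_d -> R) (hf : forall x : 'rV[R]_d, differentiable f x)
    (l : 'I_d -> R) (hl : forall i : 'I_d, 0 < l i) :
  smooth (diag_norm l) 1 f ->
  smooth (@max_norm R d) (\sum_(i < d) l i) f.
Proof.
move=> [_ _ f1]; set S := \sum_(i < d) l i.
have l0 i : 0 <= l i by exact/ltW.
have S0 : 0 < S.
  (* The index 0, available by [hd], contributes a positive term. *)
  by rewrite /S (bigD1 (Ordinal hd))//= ltr_pwDl// sumr_ge0.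
have c0 : 0 < Num.sqrt S by rewrite sqrtr_gt0.
split=> // x x'.
have -> : S = Num.sqrt S * Num.sqrt S by rewrite -expr2 sqr_sqrtr// ltW.
apply: (@le_trans _ _ (Num.sqrt S *
    dual_norm (diag_norm l) (grad f x' - grad f x))).
  apply: dual_norm_le_scale => //.
  - by rewrite /max_norm normr0.
  - move=> y y1; apply: le_trans (diag_norm_le_max_norm _ l0) _.
    rewrite /max_norm normrZ gtr0_norm ?invr_gt0// mulrA mulfV ?gt_eqF//.
    by rewrite mul1r.
  - exact: has_ubound_inner_diag_norm.
(* One factor [Num.sqrt S] cancels; the other bounds [diag_norm l (x' - x)] by the maximum norm. *)
rewrite -mulrA ler_pM2l//; apply: le_trans (f1 _ _) _.
by rewrite mul1r diag_norm_le_max_norm.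
Qed.
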